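(* Every non-wellfounded proof satisfying the saturation recurrence property can be transformed into a cyclic proof. That is: if $\pi$ is a non-wellfounded proof ($\mathsf{LNS^{\infty}_{LTL}}$-proof) of a linear nested sequent $\mathcal{G}$ and $\pi$ satisfies the saturation recurrence property, then there is a cyclic proof ($\mathsf{LNS^{cyc}_{LTL}}$-proof) of $\mathcal{G}$.
   Context: **Language.** Let $\mathsf{Atm}$ be a denumerable set of atoms. Formulae of $\mathscr{L}$ are given by $A,B ::= p \mid \bot \mid (A \to B) \mid \mathtt{X} A \mid (A \,\mathtt{U}\, B)$ with $p \in \mathsf{Atm}$. **Linear nested sequents.** A Gentzen sequent is $\Gamma\vdash\Delta$ with $\Gamma,\Delta$ finite sets of formulae. A linear nested sequent (LNS) is a nonempty finite sequence $\mathcal{G} = \Gamma_0\vdash\Delta_0 /\!/ \cdots /\!/ \Gamma_n\vdash\Delta_n$ of Gentzen sequents; $\Gamma_i\vdash\Delta_i$ is its $i$-component, $\Vert\mathcal{G}\Vert := n+1$ its length, and $\mathsf{end}(\mathcal{G}) := \Gamma_n\vdash\Delta_n$ its end component. **Rules** ($\mathsf{LNS_{LTL}}$). Here $\mathcal{G},\mathcal{H}$ are possibly empty, and the comma is set union (so in ''$\Gamma, A$'' one may have $A\in\Gamma$). Initial rules (no premises): $\mathsf{id}$: $\mathcal{G}/\!/\Gamma,p\vdash p,\Delta/\!/\mathcal{H}$; $\bot\mathsf{L}$: $\mathcal{G}/\!/\Gamma,\bot\vdash\Delta/\!/\mathcal{H}$. Their conclusions are called initial sequents. Logical rules: - ${\to}\mathsf{R}$: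 from $\mathcal{G}/\!/\Gamma,A\vdash B,\Delta/\!/\mathcal{H}$ infer $\mathcal{G}/\!/\Gamma\vdash A\to B,\Delta/\!/\mathcal{H}$. - ${\to}\mathsf{L}$: from $\mathcal{G}/\!/\Gamma,B\vdash\Delta/\!/\mathcal{H}$ and $\mathcal{G}/\!/\Gamma\vdash A,\Delta/\!/\mathcal{H}$ infer $\mathcal{G}/\!/\Gamma,A\to B\vdash\Delta/\!/\mathcal{H}$. - $\mathtt{X}\mathsf{L}_1$: from $\mathcal{G}/\!/\Gamma\vdash\Delta/\!/\Sigma,A\vdash\Pi/\!/\mathcal{H}$ infer $\mathcal{G}/\!/\Gamma,\mathtt{X}A\vdash\Delta/\!/\Sigma\vdash\Pi/\!/\mathcal{H}$. - $\mathtt{X}\mathsf{L}_2$: from $\mathcal{G}/\!/\Gamma\vdash\Delta/\!/A\vdash$ infer $\mathcal{G}/\!/\Gamma,\mathtt{X}A\vdash\Delta$. - $\mathtt{X}\mathsf{R}_1$: from $\mathcal{G}/\!/\Gamma\vdash\Delta/\!/\Sigma\vdash A,\Pi/\!/\mathcal{H}$ infer $\mathcal{G}/\!/\Gamma\vdash\mathtt{X}A,\Delta/\!/\Sigma\vdash\Pi/\!/\mathcal{H}$. - $\mathtt{X}\mathsf{R}_2$: from $\mathcal{G}/\!/\Gamma\vdash\Delta/\!/\vdash A$ infer $\mathcal{G}/\!/\Gamma\vdash\mathtt{X}A,\Delta$. - $\mathtt{U}\mathsf{L}_1$: from (left) $\mathcal{G}/\!/\Gamma,B\vdash\Delta/\!/\Sigma\vdash\Pi/\!/\mathcal{H}$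 and (right) $\mathcal{G}/\!/\Gamma,A\vdash\Delta/\!/\Sigma,A\,\mathtt{U}\,B\vdash\Pi/\!/\mathcal{H}$ infer $\mathcal{G}/\!/\Gamma,A\,\mathtt{U}\,B\vdash\Delta/\!/\Sigma\vdash\Pi/\!/\mathcal{H}$. - $\mathtt{U}\mathsf{R}_1$: from (left) $\mathcal{G}/\!/\Gamma\vdash A,B,\Delta/\!/\Sigma\vdash\Pi/\!/\mathcal{H}$ and (right) $\mathcal{G}/\!/\Gamma\vdash B,\Delta/\!/\Sigma\vdash A\,\mathtt{U}\,B,\Pi/\!/\mathcal{H}$ infer $\mathcal{G}/\!/\Gamma\vdash A\,\mathtt{U}\,B,\Delta/\!/\Sigma\vdash\Pi/\!/\mathcal{H}$. - $\mathtt{U}\mathsf{L}_2$: from (left) $\mathcal{G}/\!/\Gamma,B\vdash\Delta$ and (right) $\mathcal{G}/\!/\Gamma,A\vdash\Delta/\!/A\,\mathtt{U}\,B\vdash$ infer $\mathcal{G}/\!/\Gamma,A\,\mathtt{U}\,B\vdash\Delta$. - $\mathtt{U}\mathsf{R}_2$: from (left) $\mathcal{G}/\!/\Gamma\vdash A,B,\Delta$ and (right) $\mathcal{G}/\!/\Gamma\vdash B,\Delta/\!/\vdash A\,\mathtt{U}\,B$ infer $\mathcal{G}/\!/\Gamma\vdash A\,\mathtt{U}\,B,\Delta$. The principal formula of a logical rule is the (occurrence of the) formula explicitly displayed in its conclusion. **Derivations.** A derivation of $\mathcal{G}$ is a possibly infinite tree of LNSs with root $\mathcal{G}$ in which every parent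 node is the conclusion of a rule whose premises are its children (in finite derivations used for cyclic proofs, leaves need not be initial sequents). A path is a finite or infinite sequence of nodes in which each is the parent of the next; a branch is a maximal path starting at the root. **Traces and non-wellfounded proofs.** A trace value of $\mathcal{G}=\Gamma_0\vdash\Delta_0/\!/\cdots/\!/\Gamma_n\vdash\Delta_n$ is a pair $\langle A\,\mathtt{U}\,B,i\rangle$ with $0\le i\le n$ and $A\,\mathtt{U}\,B\in\Gamma_i$. For a rule instance $\mathsf{r}$ with conclusion $\mathcal{G}$ and premise $\mathcal{H}$, $(\langle A\,\mathtt{U}\,B,i\rangle,\langle A\,\mathtt{U}\,B,j\rangle)$ is a trace pair for $(\mathcal{G},\mathcal{H})$ iff these are trace values of $\mathcal{G}$ and $\mathcal{H}$ respectively and (1) if $A\,\mathtt{U}\,B$ is not principal in $\mathsf{r}$, then $i=j$; (2) if $A\,\mathtt{U}\,B$ is principal in $\mathsf{r}$, then $j=i+1$ and $\mathcal{H}$ is the right premise of $\mathsf{r}$. It is progressing iff $j=i+1$. A trace along a path $\{\mathcal{G}_i\}_{i}$ is a sequence of trace values $\{\tau_i\}_i$ such that each $(\tau_i,\tau_{i+1})$ is a trace pair for $(\mathcal{G}_i,\mathcal{G}_{i+1})$. A trace along an infinite path is progressing iff infinitely many of its trace pairs are progressing; an infinite path is progressing iff it has a progressing trace. A non-wellfounded proof ($\mathsf{LNS^{\infty}_{LTL}}$-proof) of $\mathcal{G}$ is a derivation of $\mathcal{G}$ in which every leaf is an initial sequent and every infinite branch has a suffix that is a progressing path. **Saturation.**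 An LNS $\mathcal{G}$ with components $\Gamma_0\vdash\Delta_0,\ldots,\Gamma_n\vdash\Delta_n$ is $i$-saturated ($0\le i\le n$) iff it is not an initial sequent and $\Gamma_i\cup\Delta_i$ contains no formula of the form $\mathtt{X}A$, $A\to B$ or $A\,\mathtt{U}\,B$. $\mathcal{G}$ is saturated iff it is $i$-saturated for each $0\le i<n$ (i.e., for every component other than the last). A derivation satisfies the saturation recurrence property (SRP) iff for every infinite branch $\{\mathcal{G}_i\}_{i\in\mathbb{N}}$ in it, infinitely many $\mathcal{G}_i$ are saturated. **Cyclic proofs.** A cyclic proof ($\mathsf{LNS^{cyc}_{LTL}}$-proof) of $\mathcal{G}$ is a tuple $(\pi,L,c)$ where (1) $\pi$ is a finite derivation of $\mathcal{G}$; (2) $L$ is a set of leaves of $\pi$ (cyclic leaves); (3) $c$ maps each leaf $\mathcal{F}\in L$ to a node $c(\mathcal{F})$ (its companion) lying on the path from the root to $\mathcal{F}$ and distinct from $\mathcal{F}$, such that $\Vert c(\mathcal{F})\Vert<\Vert\mathcal{F}\Vert$, the path from $c(\mathcal{F})$ to $\mathcal{F}$ goes through the right premise of a rule in $\{\mathtt{U}\mathsf{L}_1,\mathtt{U}\mathsf{L}_2\}$, both $c(\mathcal{F})$ and $\mathcal{F}$ are saturated, and $\mathsf{end}(c(\mathcal{F}))=\mathsf{end}(\mathcal{F})$; (4) every leaf of $\pi$ not in $L$ is an initial sequent. *)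

(* Defs.v *)
From HB Require Import structures.
From mathcomp Require Import all_boot finmap.

Set Implicit Arguments.
Unset Strict Implicit.
Unset Printing Implicit Defensive.

Local Open Scope fset_scope.

Inductive form (Atm : Type) : Type :=
| Atom of Atm
| Bot
| Imp of form Atm & form Atm
| Next of form Atm
| Until of form Atm & form Atm.

Arguments Bot {Atm}.

(* Encoding into GenTree.tree, used only to make [form Atm] a countType. *)
Fixpoint form_code (Atm : Type) (A : form Atm) : GenTree.tree Atm :=
  match A with
  | Atom p => GenTree.Leaf p
  | Bot => GenTree.Node 0 [::]
  | Imp B C => GenTree.Node 1 [:: form_code B; form_code C]
  | Next B => GenTree.Node 2 [:: form_code B]
  | Until B C => GenTree.Node 3 [:: form_code B; form_code C]
  end.

Fixpoint form_decode (Atm : Type) (t : GenTree.tree Atm) : option (form Atm) :=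
  match t with
  | GenTree.Leaf p => Some (Atom p)
  | GenTree.Node 0 [::] => Some Bot
  | GenTree.Node 1 [:: a; b] =>
      if (form_decode a, form_decode b) is (Some B, Some C)
      then Some (Imp B C) else None
  | GenTree.Node 2 [:: a] =>
      if form_decode a is Some B then Some (Next B) else None
  | GenTree.Node 3 [:: a; b] =>
      if (form_decode a, form_decode b) is (Some B, Some C)
      then Some (Until B C) else None
  | _ => None
  end.

Lemma form_codeK (Atm : Type) : pcancel (@form_code Atm) (@form_decode Atm).
Proof. by elim=> //= [B -> C ->|B ->|B -> C ->]. Qed.

HB.instance Definition _ (Atm : countType) :=
  Countable.copy (form Atm) (pcan_type (@form_codeK Atm)).

(* [(Gam, Del)] is the Gentzen sequent Gam |- Del. *)
Definition gseq (Atm : countType) : Type :=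
  ({fset form Atm} * {fset form Atm})%type.

Record lns (Atm : countType) : Type :=
  Lns { comps :> seq (gseq Atm); comps_neq_nil : comps != [::] }.

HB.instance Definition _ (Atm : countType) := [isSub for @comps Atm].
HB.instance Definition _ (Atm : countType) := [Choice of lns Atm by <:].

Lemma mk_lns_subproof (Atm : countType) (G : seq (gseq Atm)) S H :
  G ++ S :: H != [::].
Proof. by case: G. Qed.

(* G // S // H, where G and H are possibly empty. *)
Definition mk_lns (Atm : countType) (G : seq (gseq Atm)) (S : gseq Atm)
    (H : seq (gseq Atm)) : lns Atm :=
  Lns (mk_lns_subproof G S H).

(* The default sequent (fset0, fset0) is never reached for i < size g. *)
Definition component (Atm : countType) (g : lns Atm) (i : nat) : gseq Atm :=
  nth (fset0, fset0) g i.

Definition end_component (Atm : countType) (g : lns Atm) : gseq Atm :=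
  last (fset0, fset0) g.

(* A term of [rule Atm] is a rule instance, given by the values of the schematic
   variables of the rule, with Gam |- Del and Sig |- Pi the displayed
   components. Several instances may have the same conclusion and premises. *)
Inductive rule (Atm : countType) : Type :=
| Id (G : seq (gseq Atm)) (Gam : {fset form Atm}) (p : Atm)
     (Del : {fset form Atm}) (H : seq (gseq Atm))
| BotL (G : seq (gseq Atm)) (Gam Del : {fset form Atm}) (H : seq (gseq Atm))
| ImpR (G : seq (gseq Atm)) (Gam Del : {fset form Atm}) (A B : form Atm)
       (H : seq (gseq Atm))
| ImpL (G : seq (gseq Atm)) (Gam Del : {fset form Atm}) (A B : form Atm)
       (H : seq (gseq Atm))
| XL1 (G : seq (gseq Atm)) (Gam Del Sig Pi : {fset form Atm}) (A : form Atm)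
      (H : seq (gseq Atm))
| XL2 (G : seq (gseq Atm)) (Gam Del : {fset form Atm}) (A : form Atm)
| XR1 (G : seq (gseq Atm)) (Gam Del Sig Pi : {fset form Atm}) (A : form Atm)
      (H : seq (gseq Atm))
| XR2 (G : seq (gseq Atm)) (Gam Del : {fset form Atm}) (A : form Atm)
| UL1 (G : seq (gseq Atm)) (Gam Del Sig Pi : {fset form Atm}) (A B : form Atm)
      (H : seq (gseq Atm))
| UR1 (G : seq (gseq Atm)) (Gam Del Sig Pi : {fset form Atm}) (A B : form Atm)
      (H : seq (gseq Atm))
| UL2 (G : seq (gseq Atm)) (Gam Del : {fset form Atm}) (A B : form Atm)
| UR2 (G : seq (gseq Atm)) (Gam Del : {fset form Atm}) (A B : form Atm).

Definition concl (Atm : countType) (r : rule Atm) : lns Atm :=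
  match r with
  | Id G Gam p Del H => mk_lns G (Atom p |` Gam, Atom p |` Del) H
  | BotL G Gam Del H => mk_lns G (Bot |` Gam, Del) H
  | ImpR G Gam Del A B H => mk_lns G (Gam, Imp A B |` Del) H
  | ImpL G Gam Del A B H => mk_lns G (Imp A B |` Gam, Del) H
  | XL1 G Gam Del Sig Pi A H =>
      mk_lns G (Next A |` Gam, Del) ((Sig, Pi) :: H)
  | XL2 G Gam Del A => mk_lns G (Next A |` Gam, Del) [::]
  | XR1 G Gam Del Sig Pi A H =>
      mk_lns G (Gam, Next A |` Del) ((Sig, Pi) :: H)
  | XR2 G Gam Del A => mk_lns G (Gam, Next A |` Del) [::]
  | UL1 G Gam Del Sig Pi A B H =>
      mk_lns G (Until A B |` Gam, Del) ((Sig, Pi) :: H)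
  | UR1 G Gam Del Sig Pi A B H =>
      mk_lns G (Gam, Until A B |` Del) ((Sig, Pi) :: H)
  | UL2 G Gam Del A B => mk_lns G (Until A B |` Gam, Del) [::]
  | UR2 G Gam Del A B => mk_lns G (Gam, Until A B |` Del) [::]
  end.

(* Premises from left to right. *)
Definition prems (Atm : countType) (r : rule Atm) : seq (lns Atm) :=
  match r with
  | Id _ _ _ _ _ | BotL _ _ _ _ => [::]
  | ImpR G Gam Del A B H => [:: mk_lns G (A |` Gam, B |` Del) H]
  | ImpL G Gam Del A B H =>
      [:: mk_lns G (B |` Gam, Del) H; mk_lns G (Gam, A |` Del) H]
  | XL1 G Gam Del Sig Pi A H =>
      [:: mk_lns G (Gam, Del) ((A |` Sig, Pi) :: H)]
  | XL2 G Gam Del A => [:: mk_lns G (Gam, Del) [:: ([fset A], fset0)]]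
  | XR1 G Gam Del Sig Pi A H =>
      [:: mk_lns G (Gam, Del) ((Sig, A |` Pi) :: H)]
  | XR2 G Gam Del A => [:: mk_lns G (Gam, Del) [:: (fset0, [fset A])]]
  | UL1 G Gam Del Sig Pi A B H =>
      [:: mk_lns G (B |` Gam, Del) ((Sig, Pi) :: H);
          mk_lns G (A |` Gam, Del) ((Until A B |` Sig, Pi) :: H)]
  | UR1 G Gam Del Sig Pi A B H =>
      [:: mk_lns G (Gam, A |` (B |` Del)) ((Sig, Pi) :: H);
          mk_lns G (Gam, B |` Del) ((Sig, Until A B |` Pi) :: H)]
  | UL2 G Gam Del A B =>
      [:: mk_lns G (B |` Gam, Del) [::];
          mk_lns G (A |` Gam, Del) [:: ([fset Until A B], fset0)]]
  | UR2 G Gam Del A B =>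
      [:: mk_lns G (Gam, A |` (B |` Del)) [::];
          mk_lns G (Gam, B |` Del) [:: (fset0, [fset Until A B])]]
  end.

Definition right_premise : nat := 1.

Inductive side : Type := Left | Right.

(* The principal occurrence of a logical rule: component, side of the turnstile
   and formula. *)
Definition principal (Atm : countType) (r : rule Atm) :
    option (nat * side * form Atm) :=
  match r with
  | Id _ _ _ _ _ | BotL _ _ _ _ => None
  | ImpR G _ _ A B _ => Some (size G, Right, Imp A B)
  | ImpL G _ _ A B _ => Some (size G, Left, Imp A B)
  | XL1 G _ _ _ _ A _ | XL2 G _ _ A => Some (size G, Left, Next A)
  | XR1 G _ _ _ _ A _ | XR2 G _ _ A => Some (size G, Right, Next A)
  | UL1 G _ _ _ _ A B _ | UL2 G _ _ A B => Some (size G, Left, Until A B)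
  | UR1 G _ _ _ _ A B _ | UR2 G _ _ A B => Some (size G, Right, Until A B)
  end.

Definition is_UL (Atm : countType) (r : rule Atm) : bool :=
  match r with UL1 _ _ _ _ _ _ _ _ | UL2 _ _ _ _ _ => true | _ => false end.

(* The rules without premises are Id and BotL. *)
Definition initial (Atm : countType) (g : lns Atm) : Prop :=
  exists r : rule Atm, prems r = [::] /\ concl r = g.

(* A node is the list of child indices leading to it from the root; [::] is the
   root, and [rcons u k] is the k-th child of [u]. *)
Definition node : Type := seq nat.

(* [label u = None] means that [u] is not a node of the tree. [rule_at u] is the
   rule instance of which [u] is the conclusion, and None at the other leaves
   and outside the tree. The children of [u] are exactly the premises of this
   instance, in order. *)
Record derivation (Atm : countType) : Type := Derivation {
  label : node -> option (lns Atm);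
  rule_at : node -> option (rule Atm);
  derivation_root : label [::] <> None;
  derivation_step : forall u : node,
    if rule_at u is Some r then
      label u = Some (concl r) /\
      forall k : nat, label (rcons u k) = onth (prems r) k
    else forall k : nat, label (rcons u k) = None
}.

Definition derivation_of (Atm : countType) (d : derivation Atm) (g : lns Atm) :
    Prop :=
  label d [::] = Some g.

Definition in_tree (Atm : countType) (d : derivation Atm) (u : node) : Prop :=
  label d u <> None.

Definition leaf (Atm : countType) (d : derivation Atm) (u : node) : Prop :=
  in_tree d u /\ forall k : nat, ~ in_tree d (rcons u k).

Definition finite_derivation (Atm : countType) (d : derivation Atm) : Prop :=
  exists s : seq node, forall u : node, in_tree d u -> u \in s.

Definition infinite_path (Atm : countType) (d : derivation Atm)
    (p : nat -> node) : Prop :=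
  forall n : nat, in_tree d (p n) /\ exists k : nat, p n.+1 = rcons (p n) k.

Definition infinite_branch (Atm : countType) (d : derivation Atm)
    (p : nat -> node) : Prop :=
  infinite_path d p /\ p 0 = [::].

(* The candidate trace value <t.1, t.2>. *)
Definition trace_value (Atm : countType) (g : lns Atm) (t : form Atm * nat) :
    Prop :=
  [/\ exists A B : form Atm, t.1 = Until A B,
      t.2 < size g
    & t.1 \in (component g t.2).1].

(* Principality is that of the occurrence: [t.1] on the left of component [t.2].
   The same formula displayed on the right, or in another component, is a
   different occurrence. *)
Definition trace_pair (Atm : countType) (r : rule Atm) (k : nat)
    (t t' : form Atm * nat) : Prop :=
  exists2 h : lns Atm, onth (prems r) k = Some h &
  [/\ trace_value (concl r) t,
      trace_value h t',
      t'.1 = t.1,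
      principal r <> Some (t.2, Left, t.1) -> t'.2 = t.2
    & principal r = Some (t.2, Left, t.1) ->
        t'.2 = t.2.+1 /\ k = right_premise].

Definition progressing_pair (Atm : countType) (t t' : form Atm * nat) : Prop :=
  t'.2 = t.2.+1.

Definition trace_along (Atm : countType) (d : derivation Atm)
    (p : nat -> node) (tau : nat -> form Atm * nat) : Prop :=
  forall n : nat, exists (r : rule Atm) (k : nat),
    [/\ rule_at d (p n) = Some r,
        p n.+1 = rcons (p n) k
      & trace_pair r k (tau n) (tau n.+1)].

Definition progressing_path (Atm : countType) (d : derivation Atm)
    (p : nat -> node) : Prop :=
  infinite_path d p /\
  exists2 tau : nat -> form Atm * nat, trace_along d p tau &
    forall N : nat, exists2 n : nat, N <= n &
      progressing_pair (tau n) (tau n.+1).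

Definition non_wellfounded_proof (Atm : countType) (d : derivation Atm)
    (g : lns Atm) : Prop :=
  [/\ derivation_of d g,
      forall (u : node) (h : lns Atm),
        leaf d u -> label d u = Some h -> initial h
    & forall p : nat -> node, infinite_branch d p ->
        exists m : nat, progressing_path d (fun n => p (m + n)%N)].

Definition unsaturated_form (Atm : countType) (F : form Atm) : bool :=
  match F with
  | Next _ | Imp _ _ | Until _ _ => true
  | Atom _ | Bot => false
  end.

Definition i_saturated (Atm : countType) (g : lns Atm) (i : nat) : Prop :=
  ~ initial g /\
  forall F : form Atm,
    F \in (component g i).1 `|` (component g i).2 -> ~~ unsaturated_form F.

(* The last component is exempt; in particular every LNS of length 1 is
   saturated, even an initial one. *)
Definition saturated (Atm : countType) (g : lns Atm) : Prop :=
  forall i : nat, i < (size g).-1 -> i_saturated g i.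

Definition saturation_recurrence (Atm : countType) (d : derivation Atm) : Prop :=
  forall p : nat -> node, infinite_branch d p ->
    forall N : nat, exists2 n : nat, N <= n &
      exists2 g : lns Atm, label d (p n) = Some g & saturated g.

(* Both the conclusion [v] and the right premise of the UL instance lie on the
   path from [u] to [w]. *)
Definition through_right_UL (Atm : countType) (d : derivation Atm)
    (u w : node) : Prop :=
  exists (v : node) (r : rule Atm),
    [/\ rule_at d v = Some r,
        is_UL r,
        prefix u v
      & prefix (rcons v right_premise) w].

Definition companion_ok (Atm : countType) (d : derivation Atm)
    (cu u : node) : Prop :=
  [/\ prefix cu u,
      cu != u,
      through_right_UL d cu u
    & exists gc g : lns Atm,
        [/\ label d cu = Some gc /\ label d u = Some g,
            size gc < size g,
            saturated gc,
            saturated g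
          & end_component gc = end_component g]].

Definition cyclic_proof (Atm : countType) (d : derivation Atm)
    (L : {fset node}) (c : node -> node) (g : lns Atm) : Prop :=
  [/\ derivation_of d g /\ finite_derivation d,
      forall u : node, u \in L -> leaf d u,
      forall u : node, u \in L -> companion_ok d (c u) u
    & forall (u : node) (h : lns Atm),
        leaf d u -> u \notin L -> label d u = Some h -> initial h].

(* Main.v *)
(* Every component of the proof is made of subformulae of the root, so end
   components range over a finite set. On an infinite branch, a progressing
   trace crosses right premises of UL infinitely often and moves to ever later
   components, so the sizes are unbounded; with saturation recurrence this gives
   infinitely many saturated nodes of increasing size, with a right premise of
   UL between consecutive ones, and by the pigeonhole principle two of them have
   the same end component. Cutting each branch at the first node that has such a
   companion leaves a tree without infinite branches, finite by Koenig's lemma. *)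

Require Import Defs.
From mathcomp Require Import all_boot finmap.
From mathcomp Require Import boolp.

Set Implicit Arguments.
Unset Strict Implicit.
Unset Printing Implicit Defensive.

Local Open Scope fset_scope.

(** * Subformula-closed sets and sequents over them *)

Section FormulaClosure.
Variable Atm : countType.
Implicit Types (C : {fset form Atm}) (r : rule Atm) (g h : lns Atm).

Fixpoint subforms (F : form Atm) : {fset form Atm} :=
  F |` match F with
       | Atom _ | Bot => fset0
       | Imp A B | Until A B => subforms A `|` subforms B
       | Next A => subforms A
       end.

Definition immediate_subforms (F : form Atm) : {fset form Atm} :=
  match F with
  | Atom _ | Bot => fset0
  | Imp A B | Until A B => [fset A; B]
  | Next A => [fset A]
  end.

Definition subform_closed C : Prop :=
  forall F, F \in C -> immediate_subforms F `<=` C.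

Definition over C (g : seq (gseq Atm)) : bool :=
  all (fun T => (T.1 `<=` C) && (T.2 `<=` C)) g.

Lemma mem_subforms F : F \in subforms F.
Proof. by case: F => *; rewrite /= fset1U1. Qed.

Lemma subforms_closed F : subform_closed (subforms F).
Proof.
elim: F => [p||A IHA B IHB|A IHA|A IHA B IHB] G; rewrite /= !inE.
- by rewrite orbF => /eqP->; apply: fsub0set.
- by rewrite orbF => /eqP->; apply: fsub0set.
- case/orP=> [/eqP->|/orP[/IHA|/IHB] sub] /=.
  + by rewrite fsubUset !fsub1set !inE !mem_subforms !orbT.
  + by rewrite fsubsetU // fsubsetU ?sub ?orbT.
  + by rewrite fsubsetU // fsubsetU ?sub ?orbT.
- case/orP=> [/eqP->|/IHA sub] /=.
  + by rewrite fsub1set !inE mem_subforms orbT.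
  + by rewrite fsubsetU // sub orbT.
- case/orP=> [/eqP->|/orP[/IHA|/IHB] sub] /=.
  + by rewrite fsubUset !fsub1set !inE !mem_subforms !orbT.
  + by rewrite fsubsetU // fsubsetU ?sub ?orbT.
  + by rewrite fsubsetU // fsubsetU ?sub ?orbT.
Qed.

(** The union of the [subforms] of all formulae in [g] serves, a union of closed sets being
    closed. *)
Lemma closed_over_exists (g : seq (gseq Atm)) :
  exists2 C, subform_closed C & over C g.
Proof.
pose fs := flatten [seq enum_fset T.1 ++ enum_fset T.2 | T <- g].
exists (\bigcup_(F <- fs) subforms F).
  move=> G /bigfcupP[F /andP[Ffs _] GF].
  apply: fsubset_trans (subforms_closed GF) _.
  exact: bigfcup_sup.
have sub F : F \in fs -> F \in \bigcup_(F <- fs) subforms F.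
  by move=> Ffs; apply/bigfcupP; exists F; rewrite ?Ffs ?mem_subforms.
apply/allP => T Tg; apply/andP; split; apply/fsubsetP => F FT; apply: sub;
  rewrite /fs; apply/(@flatten_mapP ({fset form Atm} * {fset form Atm})%type);
  by exists T; rewrite // mem_cat FT ?orbT.
Qed.

(** A formula added in a premise is an immediate subformula of the principal formula, or the
    principal [Until] itself moved to the next component, which is in [C] already. *)
Lemma prems_over C r h :
  subform_closed C -> over C (concl r) -> h \in prems r -> over C h.
Proof.
move=> clC.
have cImp A B : Imp A B \in C -> (A \in C) && (B \in C).
  by move/clC; rewrite /= fsubUset !fsub1set.
have cUntil A B : Until A B \in C -> (A \in C) && (B \in C).
  by move/clC; rewrite /= fsubUset !fsub1set.
have cNext A : Next A \in C -> A \in C by move/clC; rewrite /= fsub1set.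
move=> over_r hr; move: over_r hr; rewrite /over.
case: r => [G Gam p Del H|G Gam Del H|G Gam Del A B H|G Gam Del A B H
  |G Gam Del Sig Pi A H|G Gam Del A|G Gam Del Sig Pi A H|G Gam Del A
  |G Gam Del Sig Pi A B H|G Gam Del Sig Pi A B H|G Gam Del A B|G Gam Del A B] //=;
  rewrite all_cat /= ?fsubUset ?fsub1set ?andbT => over_r;
  repeat match goal with E : is_true (_ && _) |- _ =>
    let E1 := fresh in let E2 := fresh in case/andP: E => E1 E2 end;
  try match goal with
  | E : is_true (Imp _ _ \in C) |- _ => case/andP: (cImp _ _ E) => ? ?
  | E : is_true (Until _ _ \in C) |- _ => case/andP: (cUntil _ _ E) => ? ?
  | E : is_true (Next _ \in C) |- _ => have ? := cNext _ E
  end;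
  rewrite !inE; try case/orP; move=> /eqP->;
  rewrite all_cat /= ?fsubUset ?fsub1set ?fsub0set;
  by repeat match goal with E : is_true _ |- _ => rewrite E {E} end.
Qed.

End FormulaClosure.

(** * Pigeonhole principle and prefixes of nodes *)

Lemma pigeonhole (T : choiceType) (E : {fset T}) (e : nat -> T) :
  (forall n, e n \in E) -> exists i j, i < j /\ e i = e j.
Proof.
move=> eE; pose s := mkseq e #|` E|.+1.
have /(uniqPn (e 0))[i [j [ij]]] : ~~ uniq s.
  apply/negP => us; have := ltnn #|` E|; rewrite -[X in X <= _](size_mkseq e).
  by rewrite uniq_leq_size // => _ /mapP[n _ ->]; apply: eE.
rewrite size_mkseq => js; rewrite !nth_mkseq ?(ltn_trans ij js) // => eij.
by exists i, j.
Qed.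

Lemma prefix_rconsE (v u : node) (k : nat) :
  prefix v (rcons u k) = (v == rcons u k) || prefix v u.
Proof.
apply/idP/orP => [/prefixP[w]|[/eqP->|vu]].
- case/lastP: w => [|w x]; first by rewrite cats0 => ->; left.
  by rewrite -rcons_cat => /rcons_inj[-> _]; right; apply: prefix_prefix.
- exact: prefix_refl.
- exact: prefix_trans vu (prefix_rcons _ _).
Qed.

(** * Derivation trees and Koenig's lemma *)

Section Derivations.
Variables (Atm : countType) (d : derivation Atm).
Implicit Types (u v w : node) (p : nat -> node).
Implicit Types (r : rule Atm) (g h : lns Atm).

Lemma in_tree_child u k : in_tree d (rcons u k) ->
  exists r h, [/\ rule_at d u = Some r, onth (prems r) k = Some h,
    label d u = Some (concl r) & label d (rcons u k) = Some h].
Proof.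
rewrite /in_tree; have := derivation_step d u.
case: (rule_at d u) => [r [lu lk]|lk]; last by rewrite lk.
by case e: (label d (rcons u k)) => [h|] // _; exists r, h; rewrite -lk e.
Qed.

Lemma in_tree_prefix u v : prefix u v -> in_tree d v -> in_tree d u.
Proof.
elim/last_ind: v => [|v k IH]; first by case: u.
rewrite prefix_rconsE => /orP[/eqP->//|uv] /in_tree_child[r [h [_ _ lv _]]].
by apply: IH => //; rewrite /in_tree lv.
Qed.

Lemma in_tree_child_lt2 u k : in_tree d (rcons u k) -> k < 2.
Proof.
case/in_tree_child=> r [h [_ rk _ _]]; rewrite ltnNge; apply/negP => k2.
suff size_prems : size (prems r) <= 2.
  by move: rk; rewrite onth_default // (leq_trans size_prems).
by case: (r).
Qed.

Definition subtree_finite u : Prop :=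
  exists s : seq node, forall v, in_tree d v -> prefix u v -> v \in s.

(** A rule has at most two premises, so the children 0 and 1 cover the subtree below [u]. *)
Lemma subtree_finite_children u :
  (forall k, subtree_finite (rcons u k)) -> subtree_finite u.
Proof.
move=> fin; have [[s0 fin0] [s1 fin1]] := (fin 0, fin 1).
exists (u :: s0 ++ s1) => v dv /prefixP[[|k w] ev].
  by rewrite ev cats0 mem_head.
rewrite -cat_rcons in ev.
have ukv : prefix (rcons u k) v by rewrite ev prefix_prefix.
rewrite inE mem_cat.
case: k ukv {ev} => [|[|k]] ukv; first by rewrite fin0 ?orbT.
  by rewrite fin1 ?orbT.
by have := in_tree_child_lt2 (in_tree_prefix ukv dv).
Qed.

(** An infinite subtree has an infinite child subtree; choosing one repeatedly from the root would
    build an infinite branch. *)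
Lemma koenig : (forall p, ~ infinite_branch d p) -> finite_derivation d.
Proof.
move=> no_branch.
suff [s fin] : subtree_finite [::].
  by exists s => u du; exact: fin du (prefix0s u).
apply: contrapT => inf.
(* The implication stays under the existential so that [choice] gives a total function; below a
   finite subtree any child will do. *)
have next u : exists k, ~ subtree_finite u -> ~ subtree_finite (rcons u k).
  apply: contrapT => none; have fin : subtree_finite u.
    apply: subtree_finite_children => k; apply: contrapT => infk.
    by apply: none; exists k.
  by apply: none; exists 0.
have [f f_next] := choice next.
pose p n := iter n (fun u => rcons u (f u)) [::].
have inf_p n : ~ subtree_finite (p n) by elim: n => [|n IH] //=; apply: f_next.
apply: (no_branch p); split=> // n; split; last by exists (f (p n)).
move=> out; apply: (inf_p n); exists [::] => v dv.
by move=> /in_tree_prefix/(_ dv)/(_ out).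
Qed.

Lemma path_prefix p n m :
  infinite_path d p -> n <= m -> prefix (p n) (p m).
Proof.
move=> dp; elim: m => [|m IH].
  by rewrite leqn0 => /eqP->; apply: prefix_refl.
rewrite leq_eqVlt => /orP[/eqP->|/IH nm]; first exact: prefix_refl.
by have [_ [k ->]] := dp m; apply: prefix_trans nm (prefix_rcons _ _).
Qed.

Lemma through_right_UL_prefix u v w :
  through_right_UL d u v -> prefix v w -> through_right_UL d u w.
Proof.
case=> x [r [rx ULr ux xv]] vw; exists x, r; split=> //.
exact: prefix_trans xv vw.
Qed.

(** An [Until] is principal on the left only in [UL1] and [UL2], where [trace_pair] forces the right
    premise; otherwise the level stays. *)
Lemma progressing_step r k t t' :
  trace_pair r k t t' ->
  t'.2 = t.2 \/ [/\ progressing_pair t t', is_UL r & k = right_premise].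
Proof.
case: t t' => [F i] [F' i'] [h _ [[[A [B /= ->]] _ _] _ _ nprinc princ]].
have [pr|npr] := pselect (principal r = Some (i, Left, Until A B)); last first.
  by left; apply: nprinc.
have [-> ->] := princ pr; right; split=> //.
by case: r pr {nprinc princ}.
Qed.

(** * Levels of a progressing trace *)

Section ProgressingPath.
Variables (p : nat -> node) (tau : nat -> form Atm * nat).
Hypothesis tr : trace_along d p tau.
Hypothesis pr : forall N,
  exists2 n, N <= n & progressing_pair (tau n) (tau n.+1).

Lemma trace_level_homo n m : n <= m -> (tau n).2 <= (tau m).2.
Proof.
apply: (@homo_leq _ (fun n => (tau n).2) leq) => // [y x z|j].
  exact: leq_trans.
have [r [k [_ _ /progressing_step[->//|[-> _ _]]]]] := tr j.
exact: leqnSn.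
Qed.

(** Levels never drop, and each progressing pair adds one. *)
Lemma trace_level_unbounded b N : exists2 n, N <= n & b <= (tau n).2.
Proof.
elim: b => [|b [n Nn bn]]; first by exists N.
have [m nm pm] := pr n; exists m.+1.
  by rewrite ltnW // ltnS (leq_trans Nn).
by rewrite pm ltnS (leq_trans bn) // trace_level_homo.
Qed.

Lemma UL_unbounded N : exists2 n, N <= n &
  exists r, [/\ rule_at d (p n) = Some r, is_UL r
              & p n.+1 = rcons (p n) right_premise].
Proof.
have [n Nn pn] := pr N; exists n => //.
have [r [k [rn pnk /progressing_step[e|[_ ULr ek]]]]] := tr n.
  by move: pn; rewrite /progressing_pair e => /esym/eqP; rewrite eqn_leq ltnn.
by exists r; split; rewrite // -ek.
Qed.

(** The level of a trace value is the index of a component, hence below the size. *)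
Lemma size_unbounded b N : exists2 n, N <= n &
  exists2 h, label d (p n) = Some h & b < size h.
Proof.
have [n Nn bn] := trace_level_unbounded b N; exists n => //.
have [r [k [rn _ [h _ [[_ lt_size _] _ _ _ _]]]]] := tr n.
have := derivation_step d (p n); rewrite rn => -[ln _].
by exists (concl r); rewrite // (leq_ltn_trans bn).
Qed.

End ProgressingPath.

Lemma size_prems r h : h \in prems r -> size (concl r) <= size h.
Proof.
move: h; apply/allP; case: r => * //=;
  by rewrite !size_cat /= ?addnS ?ltnSn ?leqnn ?leqnSn.
Qed.

(** * Companions on infinite branches *)

Section Branch.
Variable p : nat -> node.
Hypothesis dp : infinite_branch d p.

Lemma path_label n : exists h, label d (p n) = Some h.
Proof.
have [dn _] := dp.1 n.
by move: dn; rewrite /in_tree; case: (label d (p n)) => [h|] // _; exists h.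
Qed.

Lemma path_over C g : subform_closed C -> label d [::] = Some g -> over C g ->
  forall n h, label d (p n) = Some h -> over C h.
Proof.
move=> clC dg Cg; elim=> [|n IH] h; first by rewrite dp.2 dg => -[<-].
have [dn1 _] := dp.1 n.+1; have [_ [k pn]] := dp.1 n.
rewrite pn in dn1 *; have [r [h' [_ rk ln ->]]] := in_tree_child dn1.
case=> <-; apply: prems_over (IH _ ln) _ => //.
by apply/onthP; exists k.
Qed.

Lemma size_path_homo n m g h : n <= m ->
  label d (p n) = Some g -> label d (p m) = Some h -> size g <= size h.
Proof.
elim: m h => [|m IH] h; first by rewrite leqn0 => /eqP-> -> [->].
rewrite leq_eqVlt => /orP[/eqP-> -> [->]//|nm ln].
have [dm1 _] := dp.1 m.+1; have [_ [k pm]] := dp.1 m.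
rewrite pm in dm1 *; have [r [h' [_ rk lm ->]]] := in_tree_child dm1.
case=> <-; apply: leq_trans (IH _ nm ln lm) _.
by apply: size_prems; apply/onthP; exists k.
Qed.

Hypothesis progressing : exists m, progressing_path d (fun n => p (m + n)).
Hypothesis saturation : forall N, exists2 n, N <= n &
  exists2 g, label d (p n) = Some g & saturated g.

(** The order of choice matters: first a [UL] step, then a large node beyond it, then a saturated
    node beyond both, which is still large because sizes never decrease. The shift [m] skips the
    branch before its progressing suffix. *)
Lemma next_saturated n g : label d (p n) = Some g -> exists2 n', n < n' &
  exists h, [/\ label d (p n') = Some h, saturated h, size g < size h
               & through_right_UL d (p n) (p n')].
Proof.
move=> ln; have [m [_ [tau tr pr]]] := progressing.
have [n1 nn1 [r [rn1 ULr pn1]]] := UL_unbounded tr pr n.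
have [n2 n12 [h2 ln2 gh2]] := size_unbounded tr pr (size g) n1.+1.
have [n3 n23 [h ln3 sat]] := saturation (m + n2).
(* With [n1.+1] instead of [n1], the right premise itself lies on the path to [n3]. *)
have n13 : m + n1.+1 <= n3 by rewrite (leq_trans _ n23) ?leq_add2l.
exists n3.
  by rewrite (leq_trans _ n13) // addnS ltnS (leq_trans nn1) ?leq_addl.
exists h; split=> //; first exact: leq_trans gh2 (size_path_homo n23 ln2 ln3).
exists (p (m + n1)), r; split=> //.
  by apply: path_prefix dp.1 _; rewrite (leq_trans nn1) ?leq_addl.
by rewrite -pn1; apply: path_prefix dp.1 _.
Qed.

Lemma branch_companion g : label d [::] = Some g ->
  exists n u, companion_ok d u (p n).
Proof.
move=> dg; have [C clC Cg] := closed_over_exists g.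
(* The default [g] is never reached, as every node of the branch is labelled. *)
pose lab n := odflt g (label d (p n)).
have labE n : label d (p n) = Some (lab n).
  by rewrite /lab; have [h ->] := path_label n.
have next n : exists n', [/\ n < n', saturated (lab n'),
    size (lab n) < size (lab n') & through_right_UL d (p n) (p n')].
  have [n' nn' [h [ln' ? ? ?]]] := next_saturated (labE n).
  by exists n'; rewrite /lab ln'.
(* The sequence starts at [f 0] rather than 0 so that each of its nodes, including the first, is
   known to be saturated. *)
have [f f_next] := choice next; pose s j := iter j.+1 f 0.
have s_next j : s j.+1 = f (s j) by [].
have sat j : saturated (lab (s j)) by have [] := f_next (iter j f 0).
have size_s : {homo (fun j => size (lab (s j))) : i j / i < j}.
  by apply: homo_ltn ltn_trans _ => j; have [] := f_next (s j).
have le_s : {homo s : i j / i <= j}.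
  apply: homo_leq leqnn _ _ => [y x z|j]; first exact: leq_trans.
  by apply: ltnW; have [] := f_next (s j).
have [|i [j [ij eij]]] := @pigeonhole _ (fpowerset C `*` fpowerset C)
    (fun j => end_component (lab (s j))).
  move=> j; have := path_over clC dg Cg (labE (s j)).
  rewrite /over /end_component.
  case: (lab (s j)) => gs /= gs0 /allP/(_ (last (fset0, fset0) gs)) Cgs.
  rewrite in_fsetM !fpowersetE; apply: Cgs.
  by case: gs gs0 => //= T gs _; apply: mem_last.
have size_ij := size_s _ _ ij; exists (s j), (p (s i)); split.
- exact: path_prefix dp.1 (le_s _ _ (ltnW ij)).
- apply: contraTneq size_ij => eq_p; apply/negP.
  by rewrite /lab eq_p ltnn.
(* The [UL] step between [s i] and [s i.+1] suffices, as [i.+1 <= j]. *)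
- have [_ _ _ UL] := f_next (s i); apply: through_right_UL_prefix UL _.
  exact: path_prefix dp.1 (le_s _ _ ij).
- by exists (lab (s i)), (lab (s j)); split.
Qed.

End Branch.

(** * Cutting a derivation below chosen nodes *)

Section Prune.
Variable P : node -> Prop.

(** The two variants differ on whether [u] itself counts. Pruning erases labels at strictly cut
    nodes but rule instances at all cut nodes, so a topmost node satisfying [P] stays as a leaf. *)
Definition cut u : bool := `[< exists2 v, prefix v u & P v >].
Definition strictly_cut u : bool :=
  `[< exists v, [/\ prefix v u, v != u & P v] >].

(** The proper prefixes of a child are the prefixes of its parent. Hence the labels of children are
    erased exactly where the rule instance is. *)
Lemma strictly_cut_rcons u k : strictly_cut (rcons u k) = cut u.
Proof.
apply/asboolP/asboolP => [[v []]|[v vu Pv]].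
  by rewrite prefix_rconsE => /orP[->//|vu _ Pv]; exists v.
exists v; split=> //; first by rewrite prefix_rconsE vu orbT.
by apply: contraTneq (size_prefix vu) => ->; rewrite size_rcons ltnn.
Qed.

Lemma strictly_cutW u : strictly_cut u -> cut u.
Proof. by case/asboolP=> v [vu _ Pv]; apply/asboolP; exists v. Qed.

Lemma cutP u : cut u -> strictly_cut u \/ P u.
Proof.
case/asboolP=> v vu Pv; have [<-|vNu] := eqVneq v u; first by right.
by left; apply/asboolP; exists v.
Qed.

Lemma strictly_cut_prefix u v : prefix u v -> strictly_cut u -> strictly_cut v.
Proof.
move=> uv /asboolP[w [wu wNu Pw]]; apply/asboolP; exists w; split=> //.
  exact: prefix_trans wu uv.
(* If [w = v], then [u] and [w] are prefixes of each other, hence equal. *)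
apply: contraNneq wNu => wv; rewrite wv in wu *.
by move: uv; rewrite prefixE take_oversize ?size_prefix.
Qed.

Lemma prune_root :
  (if strictly_cut [::] then None else label d [::]) <> None.
Proof.
rewrite ifF; first exact: derivation_root.
by apply/negP => /asboolP[v []]; rewrite prefixs0 => ->.
Qed.

Lemma prune_step u :
  if (if cut u then None else rule_at d u) is Some r then
    (if strictly_cut u then None else label d u) = Some (concl r) /\
    forall k, (if strictly_cut (rcons u k) then None else label d (rcons u k))
      = onth (prems r) k
  else forall k,
    (if strictly_cut (rcons u k) then None else label d (rcons u k)) = None.
Proof.
have cut_k k := strictly_cut_rcons u k.
case cu: (cut u) cut_k => cut_k; first by move=> k; rewrite cut_k.
have := derivation_step d u.
case: (rule_at d u) => [r [lu lk]|lk]; last by move=> k; rewrite cut_k.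
split=> [|k]; last by rewrite cut_k.
by case: ifP => // /strictly_cutW; rewrite cu.
Qed.

(* The nodes satisfying [P] become leaves, provided that no ancestor does. *)
Definition prune : derivation Atm := Derivation prune_root prune_step.

Lemma in_pruneE u : in_tree prune u <-> in_tree d u /\ ~~ strictly_cut u.
Proof. by rewrite /in_tree /=; case: ifP => _; split=> [|[]]. Qed.

End Prune.
End Derivations.

Theorem theorem5p3 (Atm : countType)
    (Atm_infinite : exists f : nat -> Atm, injective f)
    (pi : derivation Atm) (g : lns Atm) :
  non_wellfounded_proof pi g ->
  saturation_recurrence pi ->
  exists (pi' : derivation Atm) (L : {fset node}) (c : node -> node),
    cyclic_proof pi' L c g.
Proof.
move=> [root leaves progress] sat.
pose P u := exists v, companion_ok pi v u; pose pi' := prune pi P.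
(* A branch of [pi'] is one of [pi], so some [p n] on it has a companion; but then [p n.+1] was cut
   off. *)
have fin : finite_derivation pi'.
  apply: koenig => p [pi'p p0].
  have pip : infinite_branch pi p.
    by split=> // n; have [/in_pruneE[]] := pi'p n.
  have [n Pn] := branch_companion pip (progress p pip) (sat p pip) root.
  have [/in_pruneE[_ ncut] _] := pi'p n.+1; have [_ [k pn]] := pi'p n.
  case/negP: ncut; rewrite pn strictly_cut_rcons; apply/asboolP.
  by exists (p n); rewrite ?prefix_refl.
have [s all_s] := fin.
pose L : {fset node} := [fset u in s | `[< P u /\ in_tree pi' u >]].
have LE u : in_tree pi' u -> (u \in L) = `[< P u >].
  move=> du; rewrite !inE all_s //=; apply/asboolP/asboolP => [[]//|]; by split.
(* The companion map is total on nodes; [[::]] is an arbitrary value outside [P]. *)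
have companion u : exists v, P u -> companion_ok pi v u.
  have [[v ok]|nP] := pselect (P u); first by exists v.
  by exists [::].
have [c cP] := choice companion.
exists pi', L, c; split.
- split=> //; rewrite /derivation_of /= ifF //.
  by apply/negP => /asboolP[v []]; rewrite prefixs0 => ->.
- move=> u; rewrite !inE => /andP[_ /asboolP[Pu du]]; split=> // k.
  case/in_pruneE=> _; rewrite strictly_cut_rcons => /negP; apply.
  by apply/asboolP; exists u; rewrite ?prefix_refl.
(* The companion and the [UL] step lie on the path to [u], no node of which is strictly cut, so they
   survive in [pi']. *)
- move=> u; rewrite !inE => /andP[_ /asboolP[Pu du]].
  have [cu neq [v [r [rv ULr cuv vu]]] [gc [h [[lc lu] ? ? ? ?]]]] := cP u Pu.
  have [_ ncut] := (in_pruneE pi P u).1 du.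
  have ncut_prefix w : prefix w u -> ~~ strictly_cut P w.
    by move=> wu; apply: contra ncut; apply: strictly_cut_prefix.
  split=> //.
  + exists v, r; split=> //=.
    (* The right child of [v] is not strictly cut, so [v] is not cut and keeps its rule instance. *)
    rewrite -(strictly_cut_rcons P v right_premise).
    by rewrite (negbTE (ncut_prefix _ vu)).
  + by exists gc, h; rewrite /= (negbTE ncut) (negbTE (ncut_prefix _ cu)).
(* A leaf of [pi'] outside [L] is not cut, so it lost no children and is a leaf of [pi]. *)
- move=> u h [du no_child] uL lu; have [du0 ncut] := (in_pruneE pi P u).1 du.
  have ncutu : ~~ cut P u.
    apply: contra uL => /cutP[cu|Pu]; first by rewrite cu in ncut.
    by rewrite LE //; apply/asboolP.
  apply: (leaves u); last by move: lu; rewrite /= (negbTE ncut).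
  split=> // k dk; apply: (no_child k); apply/in_pruneE; split=> //.
  by rewrite strictly_cut_rcons.
Qed.
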